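(* Let $\lambda=\mu=\eta=1$ and $I=[-1,1]$, and let $\mathsf{L}^+_n\in\mathbb{R}^{(2n+7)\times(2n+7)}$ be the matrix of $\mathcal{L}_{1,1,1}=\mathcal{I}+\mathcal{H}+\frac{\mathrm{d}}{\mathrm{d}x}+(-\Delta)^{1/2}$ from the appended sum space with additional functions $\tilde{u}_{-1},\tilde{u}_{n+1},v_0,v_{n+2}$ to the dual sum space (defined explicitly in the context). Then $$\kappa(\mathsf{L}^+_n)=\mathcal{O}(n),$$ where $\kappa(\cdot)$ denotes the 2-norm condition number of a matrix. Moreover, consider the diagonal matrix $\mathsf{P}_n=\begin{pmatrix}\mathsf{I}_5&\\&\mathsf{D}_n\end{pmatrix}$, where $\mathsf{I}_5$ is the $5\times5$ identity matrix and $\mathsf{D}_n=\mathrm{diag}(1,1,2,2,\dots,n+1,n+1)\in\mathbb{R}^{(2n+2)\times(2n+2)}$. Then there exists a constant $C>0$ such that $C$ is independent of $n$ and $$\kappa\big(\mathsf{L}^+_n(\mathsf{P}_n)^{-1}\big)=C.$$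
   Context: $\mathcal{I}$ is the identity, $\mathcal{H}[u](x)=\frac1\pi\,\mathrm{p.v.}\!\int_{\mathbb{R}}\frac{u(y)}{x-y}\,\mathrm{d}y$ is the Hilbert transform, and $(-\Delta)^{1/2}$ is the sqrt-Laplacian on $\mathbb{R}$ (Fourier multiplier $|\omega|$). The dual sum space basis on $[-1,1]$ (indexing the rows of $\mathsf{L}^+_n$) is ordered as $\tilde{U}_{-2}\,|\,V_0,\tilde{U}_{-1}\,|\,V_1,\tilde{U}_0\,|\cdots|\,V_{n+2},\tilde{U}_{n+1}$, and the appended sum space basis (indexing the columns) is ordered as $\tilde{T}_0\,|\,v_0,\tilde{u}_{-1}\,|\,v_{n+2},\tilde{u}_{n+1}\,|\,W_0,\tilde{T}_1\,|\cdots|\,W_n,\tilde{T}_{n+1}$. Here $W_n=(1-x^2)_+^{1/2}U_n$, $V_n=(1-x^2)_+^{-1/2}T_n$ (both zero for $|x|\ge1$), with $T_n,U_n$ the Chebyshev polynomials of the first and second kind; $\tilde{T}_n=T_n$ on $[-1,1]$ and $\tilde{T}_n(x)=(x-\mathrm{sgn}(x)\sqrt{x^2-1})^n$ for $|x|>1$; $\tilde{U}_{-2},\tilde{U}_{-1}$ vanish on $[-1,1]$ and equal $-|x|/\sqrt{x^2-1}$, $-\mathrm{sgn}(x)/\sqrt{x^2-1}$, respectively, for $|x|>1$; $\tilde{U}_0=\tilde{T}_0+\tilde{U}_{-2}$, $\tilde{U}_n=2\tilde{T}_n+\tilde{U}_{n-2}$ for $n\ge1$. The additional functions satisfy $\mathcal{L}_{1,1,1}v_j=V_j$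 and $\mathcal{L}_{1,1,1}\tilde{u}_j=\tilde{U}_j$. Explicitly, $\mathsf{L}^+_n$ is as follows. Partition the $2n+7$ rows into a first row followed by $n+3$ blocks of size $2$ (block rows $0,\dots,n+2$). The first column has $-1$ in row $1$ and $1$ in row $5$ (the row of $\tilde{U}_0$), and zeros elsewhere. Columns $2,3,4,5$ are the unit vectors with a $1$ in the rows of $V_0$, $\tilde{U}_{-1}$, $V_{n+2}$, $\tilde{U}_{n+1}$, respectively (rows $2$, $3$, $2n+6$, $2n+7$). The remaining $2n+2$ columns are grouped into blocks of size $2$, $k=0,\dots,n$; with $\mathsf{N}=\begin{pmatrix}-1&0\\0&1\end{pmatrix}$ and $\mathsf{M}=\begin{pmatrix}0&1\\1&0\end{pmatrix}$, block $k$ has $-(\mathsf{N}+\mathsf{M})/2$ in block row $k$, $(k+1)(\mathsf{N}+\mathsf{M})$ in block row $k+1$, $(\mathsf{N}+\mathsf{M})/2$ in block row $k+2$, and zeros elsewhere.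
   Formalization: The equality κ(L⁺_n P_n⁻¹) = C for all n is false (κ ≈ 3.60 for n = 0 but ≈ 3.12 for n = 1); it is replaced by: κ(L⁺_n P_n⁻¹) is bounded uniformly in n and converges to a constant C > 0 as n → ∞. *)

(* Defs.v *)
From HB Require Import structures.
From mathcomp Require Import all_boot all_order all_algebra.
From mathcomp Require Import all_classical all_reals all_analysis.

Set Implicit Arguments.
Unset Strict Implicit.
Unset Printing Implicit Defensive.

Import Order.TTheory GRing.Theory Num.Theory.
Import numFieldNormedType.Exports.

Local Open Scope classical_set_scope.
Local Open Scope ring_scope.

(* The norm the library puts on matrices is the max norm. *)
Definition norm2 (R : realType) (m : nat) (x : 'cV[R]_m) : R :=
  Num.sqrt (\sum_i x i 0 ^+ 2).

Definition opnorm2 (R : realType) (m p : nat) (A : 'M[R]_(m, p)) : R :=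
  sup [set norm2 (A *m x) | x in [set x : 'cV[R]_p | norm2 x <= 1]].

(* Only meaningful for invertible A, since [invmx A = A] when A is singular. *)
Definition cond2 (R : realType) (m : nat) (A : 'M[R]_m) : R :=
  opnorm2 A * opnorm2 (invmx A).

Definition Nblk (R : realType) : 'M[R]_2 :=
  diag_mx (\row_j (if j == 0 then -1 else 1)).

Definition Mblk (R : realType) : 'M[R]_2 := \matrix_(a, b) (a != b)%:R.

(* The 2 x 2 block in block row r (the first row of the matrix is outside all
   block rows) and block column k (the first five columns are outside all
   block columns). *)
Definition Lblock (R : realType) (r k : nat) : 'M[R]_2 :=
  if r == k then - (2^-1 *: (Nblk R + Mblk R))
  else if r == k.+1 then k.+1%:R *: (Nblk R + Mblk R)
  else if r == k.+2 then 2^-1 *: (Nblk R + Mblk R)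
  else 0.

(* Indices start at 0.  Rows follow the dual sum space basis
     U~_{-2} | V_0, U~_{-1} | V_1, U~_0 | ... | V_{n+2}, U~_{n+1},
   columns the appended sum space basis
     T~_0 | v_0, u~_{-1} | v_{n+2}, u~_{n+1} | W_0, T~_1 | ... | W_n, T~_{n+1},
   so that 5 + (2n + 2) = 2n + 7 is the common dimension. *)
Definition Lentry (R : realType) (n i j : nat) : R :=
  match j with
  | 0 => if i == 0%N then -1 else if i == 4%N then 1 else 0
  | 1 => (i == 1%N)%:R
  | 2 => (i == 2%N)%:R
  | 3 => (i == 2 * n + 5)%N%:R
  | 4 => (i == 2 * n + 6)%N%:R
  | q.+4.+1 =>
      if i is p.+1 then
        Lblock R p./2 q./2 (inord (odd p)) (inord (odd q))
      else 0
  end.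

Definition Lplus (R : realType) (n : nat) : 'M[R]_(5 + (2 * n + 2)) :=
  \matrix_(i, j) Lentry R n i j.

Definition Dmx (R : realType) (n : nat) : 'M[R]_(2 * n + 2) :=
  diag_mx (\row_j (j./2.+1)%:R).

Definition Pmx (R : realType) (n : nat) : 'M[R]_(5 + (2 * n + 2)) :=
  block_mx 1%:M 0 0 (Dmx R n).

(* Main.v *)
(* N + M is sqrt 2 times an orthogonal matrix, so multiplying every pair of W/T
   coordinates by N + M turns A_n := L_n P_n^-1 into two uncoupled scalar
   recurrences, one for the V rows and one for the U rows (only the first column
   enters as a source term).  In the unscaled coordinates h_1, ..., h_{n+1}, the
   inner rows read  r h_r + (h_{r-1} - h_{r+1}) / 2.  Testing them against r h_r,
   the skew part contributes only the sum of h_r h_{r+1} / 2, which the diagonal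
   part absorbs; this bounds A_n^-1 uniformly, and A_n is plainly bounded.
   Then cond (L_n) = O(n) follows from |P_n| <= n + 1 and |P_n^-1| <= 1.

   For the limit, extend a vector y by zero from size n to size m >= n.  The
   columns of v_{n+2} and u~_{n+1} move to rows which the other columns no longer
   meet, and |A_n y|^2 - |A_m y|^2 is the cross term that disappears; it is
   O(1/n) |y|^2.  Hence |A_n|^2 <= |A_m|^2 + O(1/n), and the same for the
   inverses; bounded sequences with this property converge. *)
Require Import Defs.
From HB Require Import structures.
From mathcomp Require Import all_boot all_order all_algebra.
From mathcomp Require Import all_classical all_reals all_analysis.
From mathcomp Require Import ring lra zify.

Set Implicit Arguments.
Unset Strict Implicit.
Unset Printing Implicit Defensive.

Import Order.TTheory GRing.Theory Num.Theory.
Import numFieldNormedType.Exports.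

Local Open Scope classical_set_scope.
Local Open Scope ring_scope.

(** * The scalar recurrence: bounds from above and below, and dependence on the size *)

Section Recurrence.
Variable R : realType.
Implicit Types (h : nat -> R) (al be tau : R).

(* Used for h with h 0 = 0, so that the truncated predecessor is harmless. *)
Definition skew_part h r : R := (h r.-1 - h r.+1) / 2.

(* [al], [be] and [tau] stand for the coordinates on the two unit columns and on
   the first column. *)
Definition rec_row n al be tau h r : R :=
  (r == 0%N)%:R * al + (r == 1%N)%:R * tau + (r == n.+2)%:R * be
  + (r%:R * h r + skew_part h r).

Definition rec_sqnorm n al be tau h : R :=
  \sum_(r < n.+3) rec_row n al be tau h r ^+ 2.

(** The numbers [r%:R * h r] are the rotated coordinates after preconditioning, so this measures the
    input, while [rec_sqnorm] measures the output. *)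
Definition weighted_sqnorm n h : R := \sum_(r < n.+3) (r%:R * h r) ^+ 2.

Lemma weighted_sqnorm_ge0 n h : 0 <= weighted_sqnorm n h.
Proof. by apply: sumr_ge0 => r _; apply: sqr_ge0. Qed.

Lemma rec_sqnorm_ge0 n al be tau h : 0 <= rec_sqnorm n al be tau h.
Proof. by apply: sumr_ge0 => r _; apply: sqr_ge0. Qed.

Lemma sum_delta (N k : nat) (F : nat -> R) : ((N <= k)%N -> F k = 0) ->
  \sum_(i < N) (val i == k)%:R * F i = F k.
Proof.
case: (ltnP k N) => [kN _|Nk ->] //.
  rewrite (bigD1 (Ordinal kN)) //= eqxx mul1r big1 ?addr0 // => i ik.
  by case: eqP => [e|]; rewrite ?mul0r //; case/eqP: ik; apply: val_inj.
rewrite big1 // => i _; case: eqP => [e|]; rewrite ?mul0r //.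
by move: Nk; rewrite -e leqNgt ltn_ord.
Qed.

Lemma sum_pointmass (N k : nat) (c : R) : (k < N)%N ->
  \sum_(i < N) (val i == k)%:R * c = c.
Proof. by move=> kN; rewrite (sum_delta (F := fun=> c)) // leqNgt kN. Qed.

Lemma sqr_le_weighted h r : h 0%N = 0 -> h r ^+ 2 <= (r%:R * h r) ^+ 2.
Proof.
case: r => [->|r _]; first by rewrite mulr0.
rewrite exprMn ler_peMl ?sqr_ge0 // -natrX ler1n.
by rewrite expn_gt0.
Qed.

Lemma sum_sqr_shiftS h N :
  \sum_(r < N) h r.+1 ^+ 2 = \sum_(r < N) h r ^+ 2 - h 0%N ^+ 2 + h N ^+ 2.
Proof.
elim: N => [|N IH]; first by rewrite !big_ord0; ring.
by rewrite !big_ord_recr /= IH; ring.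
Qed.

Lemma sum_sqr_pred h N : h 0%N = 0 ->
  \sum_(r < N.+1) h r.-1 ^+ 2 = \sum_(r < N) h r ^+ 2.
Proof. by move=> h0; rewrite big_ord_recl /= h0 expr0n add0r. Qed.

Lemma sum_sqr_le_weighted n h : h 0%N = 0 ->
  \sum_(r < n.+3) h r ^+ 2 <= weighted_sqnorm n h.
Proof. by move=> h0; apply: ler_sum => r _; apply: sqr_le_weighted. Qed.

Lemma sum_sqr_pred_le n h : h 0%N = 0 ->
  \sum_(r < n.+3) h r.-1 ^+ 2 <= weighted_sqnorm n h.
Proof.
move=> h0; apply: le_trans (sum_sqr_le_weighted n h0).
rewrite sum_sqr_pred // [leRHS]big_ord_recr /= ler_wpDr ?sqr_ge0 //.
Qed.

Lemma sum_sqr_succ_le n h : h 0%N = 0 -> (forall r, (n.+1 < r)%N -> h r = 0) ->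
  \sum_(r < n.+3) h r.+1 ^+ 2 <= weighted_sqnorm n h.
Proof.
move=> h0 hn; apply: le_trans (sum_sqr_le_weighted n h0).
by rewrite sum_sqr_shiftS h0 (hn n.+3) ?expr0n ?subr0 ?addr0 //=; lia.
Qed.

Lemma rec_sqnorm_le n al be tau h :
  h 0%N = 0 -> (forall r, (n.+1 < r)%N -> h r = 0) ->
  rec_sqnorm n al be tau h
  <= 10 * (al ^+ 2 + be ^+ 2 + tau ^+ 2 + weighted_sqnorm n h).
Proof.
move=> h0 hn.
(* Cauchy-Schwarz for five summands, then [(e - f) ^+ 2 <= 2 * (e ^+ 2 + f ^+ 2)] for the skew
   part. *)
have le_row r : rec_row n al be tau h r ^+ 2 <=
    5 * ((r == 0%N)%:R * al ^+ 2 + (r == 1%N)%:R * tau ^+ 2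
         + (r == n.+2)%:R * be ^+ 2 + (r%:R * h r) ^+ 2)
    + 5 / 2 * (h r.-1 ^+ 2 + h r.+1 ^+ 2).
  rewrite /rec_row /skew_part.
  have sqb (b : bool) (x : R) : b%:R * x ^+ 2 = (b%:R * x) ^+ 2.
    by case: b; rewrite ?mul1r ?mul0r ?expr0n.
  rewrite !sqb.
  move: (_ * al) (_ * tau) (_ * be) (r%:R * _) (h r.-1) (h r.+1) => a b c d e f.
  have := sqr_ge0 (a - b); have := sqr_ge0 (a - c); have := sqr_ge0 (a - d).
  have := sqr_ge0 (b - c); have := sqr_ge0 (b - d); have := sqr_ge0 (c - d).
  have := sqr_ge0 (a - (e-f)/2); have := sqr_ge0 (b - (e-f)/2).
  have := sqr_ge0 (c - (e-f)/2); have := sqr_ge0 (d - (e-f)/2).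
  have := sqr_ge0 (e + f).
  lra.
apply: le_trans (ler_sum _ (fun (r : 'I_n.+3) _ => le_row r)) _.
rewrite big_split /= -!mulr_sumr !big_split /= !sum_pointmass //.
have := sum_sqr_pred_le n h0; have := sum_sqr_succ_le h0 hn.
rewrite -/(weighted_sqnorm n h).
have := sqr_ge0 al; have := sqr_ge0 be; have := sqr_ge0 tau.
have : 0 <= weighted_sqnorm n h by apply: sumr_ge0 => r _; apply: sqr_ge0.
lra.
Qed.
(** Summation by parts: after an index shift the product [h r * h r.+1] carries the weights [r.+1]
    and [- r], which leave [1], and a boundary term at [N]. *)
Lemma sum_weighted_skew h N : h 0%N = 0 ->
  \sum_(r < N) r%:R * h r * skew_part h r
  = (\sum_(r < N) h r * h r.+1 - N%:R * h N.-1 * h N) / 2.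
Proof.
move=> h0; elim: N => [|N IH]; first by rewrite !big_ord0 h0; ring.
rewrite !big_ord_recr /= IH /skew_part -natr1; case: N {IH} => [|N] /=.
  by rewrite !big_ord0 h0; lra.
by field.
Qed.

(** Testing against [r%:R * h r] does not see [al] and [be], because [h] vanishes at [0] and [n.+2];
    they are recovered from the first and last rows. The source [tau] stays on the right, to be paid
    for by the row of [U~_{-2}]. *)
Lemma rec_sqnorm_ge n al be tau h :
  h 0%N = 0 -> (forall r, (n.+1 < r)%N -> h r = 0) ->
  al ^+ 2 + be ^+ 2 + weighted_sqnorm n h
  <= 20 * (rec_sqnorm n al be tau h + tau ^+ 2).
Proof.
move=> h0 hn; set G := rec_sqnorm _ _ _ _ _; set Y := weighted_sqnorm n h.
pose g := rec_row n al be tau h.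
have Gterm r : (r < n.+3)%N -> g r ^+ 2 <= G.
  move=> rn; rewrite /G /rec_sqnorm (bigD1 (Ordinal rn)) //= ler_wpDr //.
  by apply: sumr_ge0 => i _; apply: sqr_ge0.
have Yterm r : (r < n.+3)%N -> h r ^+ 2 <= Y.
  move=> rn; apply: le_trans (sqr_le_weighted _ h0) _.
  rewrite /Y /weighted_sqnorm (bigD1 (Ordinal rn)) //= ler_wpDr //.
  by apply: sumr_ge0 => i _; apply: sqr_ge0.
have G_ge0 : 0 <= G by apply: sumr_ge0 => i _; apply: sqr_ge0.
(* With [d = r%:R * h r] and [x] the row without its source, [2 * d * x - d ^+ 2 / 2 <= 2 * x ^+ 2];
   removing the source from [g r] costs another factor [2]. *)
have row r : (r < n.+3)%N ->
    (r%:R * h r) ^+ 2 * (3 / 2) + 2 * (r%:R * h r * skew_part h r) -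
    (4 * g r ^+ 2 + 4 * ((r == 1%N)%:R * tau ^+ 2)) <= 0.
  move=> rn; rewrite /g /rec_row.
  have e0 : (r == 0%N)%:R * al * (r%:R * h r) = 0.
    by case: eqP => [->|]; rewrite ?h0 ?mulr0 ?mul0r.
  have e2 : (r == n.+2)%:R * be * (r%:R * h r) = 0.
    by case: eqP => [->|]; rewrite ?(hn n.+2) // ?mulr0 ?mul0r.
  have e1 : (r == 1%N)%:R * tau ^+ 2 = ((r == 1%N)%:R * tau) ^+ 2.
    by case: eqP; rewrite ?mul1r // !mul0r expr0n.
  rewrite e1; move: e0 e2.
  move: (_ * al) (_ * tau) (_ * be) (r%:R * h r) (skew_part h r) => a b c d s ad cd.
  have := sqr_ge0 (d - 2 * (a + c + (d + s))).
  have := sqr_ge0 (a + b + c + (d + s) + b); lra.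
have Y_le : Y * (3 / 2) + 2 * (\sum_(r < n.+3) r%:R * h r * skew_part h r)
    - (4 * G + 4 * tau ^+ 2) <= 0.
  have := @sumr_le0 R _ _ predT _ (fun (r : 'I_n.+3) _ => row r (ltn_ord r)).
  move=> /(_ (index_enum _)).
  by rewrite sumrB !big_split /= -mulr_suml -!mulr_sumr sum_pointmass.
(* The boundary term vanishes, and [(h r + h r.+1) ^+ 2 >= 0] bounds the remaining products from
   below. *)
have S_ge : - Y <= 2 * (\sum_(r < n.+3) r%:R * h r * skew_part h r).
  rewrite sum_weighted_skew // (hn n.+3) 1?ltnW // mulr0 subr0.
  rewrite (mulrC 2) -mulrA mulVf ?pnatr_eq0 // mulr1.
  have := sum_sqr_le_weighted n h0; have := sum_sqr_succ_le h0 hn.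
  rewrite -/Y => Y1 Y2.
  have : 0 <= \sum_(r < n.+3) (h r + h r.+1) ^+ 2.
    by apply: sumr_ge0 => r _; apply: sqr_ge0.
  under eq_bigr do rewrite sqrrD.
  by rewrite !big_split /=; lra.
have al_le : al ^+ 2 <= 2 * G + Y / 2.
  have := Gterm 0%N isT; have := Yterm 1%N isT.
  rewrite /g /rec_row /skew_part /= h0; have := sqr_ge0 (al - h 1%N). lra.
have be_le : be ^+ 2 <= 2 * G + Y / 2.
  have := Gterm n.+2 (ltnSn _); have := Yterm n.+1 (ltnW (ltnSn _)).
  rewrite /g /rec_row /skew_part /= eqxx mulr1n (hn n.+2) // (hn n.+3) // mulr0.
  have := sqr_ge0 (be + h n.+1). lra.
(* [Y_le] and [S_ge] give [Y <= 8 * (G + tau ^+ 2)], and the left side is at most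
   [4 * G + 2 * Y]. *)
have := sqr_ge0 tau; lra.
Qed.

(** Only the last row involves [be]; the rows split off from it have the same formula in every
    size. *)
Lemma rec_sqnorm_recr n al be tau h :
  rec_sqnorm n al be tau h =
  \sum_(r < n.+2) rec_row n al 0 tau h r ^+ 2
  + (be + rec_row n al 0 tau h n.+2) ^+ 2.
Proof.
rewrite /rec_sqnorm big_ord_recr /=; congr (_ + _).
  apply: eq_bigr => r _; congr (_ ^+ 2).
  by rewrite /rec_row (ltn_eqF (ltn_ord r)) !mul0r.
by rewrite /rec_row /= eqxx mulr0 !mul0r mul1r !add0r.
Qed.

(** In size [n] the row [n.+2] holds both [be] and [h n.+1 / 2]; in size [m] these lie in different
    rows, so the mixed term of the square is lost. *)
Lemma rec_sqnorm_widen n m al be tau h :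
  h 0%N = 0 -> (forall r, (n.+1 < r)%N -> h r = 0) -> (n < m)%N ->
  rec_sqnorm n al be tau h = rec_sqnorm m al be tau h + be * h n.+1.
Proof.
move=> h0 hn nm; rewrite !rec_sqnorm_recr.
have indep p q r : rec_row p al 0 tau h r = rec_row q al 0 tau h r.
  by rewrite /rec_row !mulr0.
have tail r : (n.+2 < r)%N -> rec_row n al 0 tau h r = 0.
  case: r => [|[|r]] // nr.
  by rewrite /rec_row /skew_part /= !mul0r !hn ?mulr0 ?subr0 ?mul0r ?addr0 //; lia.
have -> : \sum_(r < m.+2) rec_row m al 0 tau h r ^+ 2
    = \sum_(r < n.+3) rec_row n al 0 tau h r ^+ 2.
  under eq_bigr do rewrite (indep m n).
  rewrite -(subnKC nm) -!addSn big_split_ord /= [X in _ + X]big1 ?addr0 // => r _.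
  by rewrite tail ?expr0n //; lia.
rewrite (indep m n) (tail m.+2) // [X in _ = X + _ + _]big_ord_recr /=.
have -> : rec_row n al 0 tau h n.+2 = h n.+1 / 2.
  rewrite /rec_row /skew_part /= (hn n.+2) // (hn n.+3) // !mulr0.
  by rewrite !mul0r subr0 !add0r.
by field.
Qed.

(** The norm controls [n.+1%:R * h n.+1], so [h n.+1] itself gains the factor [n.+1%:R^-1]. *)
Lemma rec_sqnorm_widen_dist n m al be tau h :
  h 0%N = 0 -> (forall r, (n.+1 < r)%N -> h r = 0) -> (n <= m)%N ->
  `|rec_sqnorm n al be tau h - rec_sqnorm m al be tau h|
  <= (be ^+ 2 + weighted_sqnorm n h) / n.+1%:R.
Proof.
move=> h0 hn; have Y_ge0 : 0 <= weighted_sqnorm n h.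
  by apply: sumr_ge0 => r _; apply: sqr_ge0.
rewrite leq_eqVlt => /predU1P[<-|nm].
  by rewrite subrr normr0 divr_ge0 // addr_ge0 // sqr_ge0.
rewrite (rec_sqnorm_widen _ _ _ h0 hn nm) [_ + be * _]addrC addrK.
rewrite ler_pdivlMr ?ltr0n // -[X in _ * X]normr_nat -normrM.
have : (n.+1%:R * h n.+1) ^+ 2 <= weighted_sqnorm n h.
  rewrite /weighted_sqnorm (bigD1 (Ordinal (ltnW (ltnSn n.+2)))) //= ler_wpDr //.
  by apply: sumr_ge0 => i _; apply: sqr_ge0.
rewrite -mulrA [h _ * _]mulrC; move: (_ * h _) => c.
have := sqr_ge0 be; have := sqr_ge0 (be - c); have := sqr_ge0 (be + c).
by rewrite ler_norml => *; apply/andP; split; lra.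
Qed.
End Recurrence.

(** * The spectral norm, its inverse counterpart and the condition number *)

Section SpectralNorm.
Variable R : realType.

Lemma sqr_le_of_le (x K : R) : 0 <= x -> x <= K -> x ^+ 2 <= K ^+ 2.
Proof. by move=> x0 xK; rewrite ler_pXn2r ?nnegrE // (le_trans x0). Qed.

Lemma le_sqrt_sqr (x K : R) : 0 <= x -> 0 <= K -> x <= Num.sqrt K -> x ^+ 2 <= K.
Proof. by move=> x0 K0 xK; rewrite -[leRHS]sqr_sqrtr // sqr_le_of_le. Qed.

Lemma norm2_ge0 m (x : 'cV[R]_m) : 0 <= norm2 x.
Proof. exact: sqrtr_ge0. Qed.

Lemma sqr_norm2 m (x : 'cV[R]_m) : norm2 x ^+ 2 = \sum_i x i 0 ^+ 2.
Proof. by rewrite sqr_sqrtr // sumr_ge0 // => i _; rewrite sqr_ge0. Qed.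

Lemma norm2_le m p (x : 'cV[R]_m) (y : 'cV[R]_p) (k : R) : 0 <= k ->
  norm2 x ^+ 2 <= k ^+ 2 * norm2 y ^+ 2 -> norm2 x <= k * norm2 y.
Proof.
by move=> k0; rewrite -exprMn ler_pXn2r ?nnegrE ?mulr_ge0 ?norm2_ge0.
Qed.

Lemma norm20 m : norm2 (0 : 'cV[R]_m) = 0.
Proof. by rewrite /norm2 big1 ?sqrtr0 // => i _; rewrite mxE expr0n. Qed.

Lemma norm2_eq0 m (x : 'cV[R]_m) : norm2 x = 0 -> x = 0.
Proof.
move=> x0; have := sqr_norm2 x; rewrite x0 expr0n /= => /esym /eqP.
rewrite psumr_eq0 => [/allP xi0|i _]; last exact: sqr_ge0.
apply/matrixP => i j; rewrite ord1 mxE; apply/eqP; rewrite -sqrf_eq0.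
by apply: xi0; rewrite mem_index_enum.
Qed.

Lemma norm2Z m (x : 'cV[R]_m) a : norm2 (a *: x) = `|a| * norm2 x.
Proof.
rewrite /norm2; under eq_bigr do rewrite mxE exprMn.
by rewrite -mulr_sumr sqrtrM ?sqr_ge0 // sqrtr_sqr.
Qed.

(** Any finite bound will do: it makes the supremum in [opnorm2] genuine rather than a default
    value. *)
Lemma norm2_mulmx_bounded m p (A : 'M[R]_(m, p)) :
  exists K : R, forall x, norm2 (A *m x) <= K * norm2 x.
Proof.
exists (Num.sqrt (\sum_i (\sum_j `|A i j|) ^+ 2)) => x.
apply: norm2_le; rewrite ?sqrtr_ge0 // [leLHS]sqr_norm2 sqr_sqrtr; last first.
  by apply: sumr_ge0 => i _; apply: sqr_ge0.
rewrite mulr_suml; apply: ler_sum => i _.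
rewrite -exprMn -real_normK ?num_real // ler_pXn2r ?nnegrE ?normr_ge0 //; last first.
  by rewrite mulr_ge0 ?norm2_ge0 // sumr_ge0.
rewrite mxE (le_trans (ler_norm_sum _ _ _)) // mulr_suml ler_sum // => j _.
rewrite normrM ler_wpM2l // -(@ler_pXn2r _ 2) ?nnegrE ?norm2_ge0 //.
rewrite real_normK ?num_real // sqr_norm2 (bigD1 j) //= ler_wpDr //.
by apply: sumr_ge0 => k _; apply: sqr_ge0.
Qed.

Lemma opnorm2_has_sup m p (A : 'M[R]_(m, p)) :
  has_sup [set norm2 (A *m x) | x in [set x : 'cV[R]_p | norm2 x <= 1]].
Proof.
split; first by exists (norm2 (A *m 0)), 0; rewrite //= norm20.
have [K AK] := norm2_mulmx_bounded A.
exists `|K| => _ [x /= x1 <-]; apply: le_trans (AK x) _.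
apply: le_trans (ler_wpM2r (norm2_ge0 x) (ler_norm K)) _.
by rewrite ler_piMr.
Qed.

Lemma opnorm2_ge0 m p (A : 'M[R]_(m, p)) : 0 <= opnorm2 A.
Proof.
apply: le_trans (ub_le_sup (opnorm2_has_sup A).2 _); first exact: (norm2_ge0 (A *m 0)).
by exists 0; rewrite //= norm20.
Qed.

Lemma norm2_mulmx_le m p (A : 'M[R]_(m, p)) x :
  norm2 (A *m x) <= opnorm2 A * norm2 x.
Proof.
have [/norm2_eq0->|x0] := eqVneq (norm2 x) 0; first by rewrite mulmx0 !norm20 mulr0.
have x_gt0 : 0 < norm2 x by rewrite lt0r x0 norm2_ge0.
rewrite -ler_pdivrMr // mulrC.
have -> : (norm2 x)^-1 * norm2 (A *m x) = norm2 (A *m ((norm2 x)^-1 *: x)).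
  by rewrite -scalemxAr norm2Z gtr0_norm ?invr_gt0.
apply: (ub_le_sup (opnorm2_has_sup A).2); exists ((norm2 x)^-1 *: x) => //=.
by rewrite norm2Z gtr0_norm ?invr_gt0 // mulVf.
Qed.

Lemma opnorm2_le m p (A : 'M[R]_(m, p)) K : 0 <= K ->
  (forall x, norm2 (A *m x) <= K * norm2 x) -> opnorm2 A <= K.
Proof.
move=> K0 AK; apply: ge_sup; first exact: (opnorm2_has_sup A).1.
by move=> _ [x /= x1 <-]; apply: le_trans (AK x) _; rewrite ler_piMr.
Qed.

Lemma opnorm2_mul_le m p q (A : 'M[R]_(m, p)) (B : 'M[R]_(p, q)) :
  opnorm2 (A *m B) <= opnorm2 A * opnorm2 B.
Proof.
apply: opnorm2_le => [|x]; first by rewrite mulr_ge0 ?opnorm2_ge0.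
rewrite -mulmxA (le_trans (norm2_mulmx_le _ _)) // -mulrA.
by rewrite ler_wpM2l ?opnorm2_ge0 ?norm2_mulmx_le.
Qed.

Lemma opnorm2_diag_le m (d : 'rV[R]_m) K : 0 <= K ->
  (forall j, `|d 0 j| <= K) -> opnorm2 (diag_mx d) <= K.
Proof.
move=> K0 dK; apply: opnorm2_le => // x; apply: norm2_le => //.
rewrite !sqr_norm2 mulr_sumr; apply: ler_sum => i _.
rewrite mul_diag_mx mxE exprMn ler_wpM2r ?sqr_ge0 //.
by rewrite -real_normK ?num_real // ler_pXn2r ?nnegrE ?normr_ge0.
Qed.

(** Such a matrix has trivial kernel; [det0P] speaks of row vectors, hence the transposes. *)
Lemma unitmx_bounded_below m (A : 'M[R]_m) K :
  (forall x, norm2 x <= K * norm2 (A *m x)) -> A \in unitmx.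
Proof.
move=> AK; rewrite -unitmx_tr unitmxE unitfE; apply/det0P => -[v v0 vA].
case/negP: v0; rewrite -(inj_eq (@trmx_inj _ _ _)) trmx0; apply/eqP/norm2_eq0.
apply/eqP; rewrite eq_le norm2_ge0 andbT (le_trans (AK _)) //.
by rewrite -[A]trmxK -trmx_mul vA trmx0 norm20 mulr0.
Qed.

Lemma opnorm2_invmx_le m (A : 'M[R]_m) K : 0 <= K ->
  (forall x, norm2 x <= K * norm2 (A *m x)) -> opnorm2 (invmx A) <= K.
Proof.
move=> K0 AK; apply: opnorm2_le => // x.
by rewrite (le_trans (AK _)) // mulKVmx // (unitmx_bounded_below AK).
Qed.

Lemma norm2_le_invmx m (A : 'M[R]_m) x : A \in unitmx ->
  norm2 x <= opnorm2 (invmx A) * norm2 (A *m x).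
Proof.
by move=> Au; rewrite -[leLHS](congr1 (@norm2 R m) (mulKmx Au x)) norm2_mulmx_le.
Qed.

(** This keeps the limit of the condition numbers away from zero; a single unit vector is enough. *)
Lemma cond2_ge1 m (A : 'M[R]_m.+1) : A \in unitmx -> 1 <= cond2 A.
Proof.
move=> Au; pose x : 'cV[R]_m.+1 := delta_mx 0 0.
have x1 : norm2 x = 1.
  apply/eqP; rewrite -(@eqrXn2 _ 2) ?norm2_ge0 // expr1n sqr_norm2.
  rewrite (bigD1 0) //= big1 ?mxE ?eqxx ?expr1n ?addr0 // => i /negPf i0.
  by rewrite mxE i0 expr0n.
rewrite -{1}x1 (le_trans (norm2_le_invmx x Au)) // /cond2 mulrC.
by rewrite ler_wpM2r ?opnorm2_ge0 // -[leRHS]mulr1 -x1 norm2_mulmx_le.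
Qed.

End SpectralNorm.

(** The sequence [b] comes close to its supremum at some [n0], and later terms can fall below [b n0]
    only by [c / m.+1%:R], which tends to zero. *)
Lemma almost_nondecreasing_cvg (R : realType) (a : nat -> R) c K :
  (forall n, a n <= K) -> (forall n m, (n <= m)%N -> a n <= a m + c / n.+1%:R) ->
  cvgn a.
Proof.
move=> aK mono; pose b n := a n - c / n.+1%:R.
have ub : has_sup (range b).
  split; first by exists (b 0%N), 0%N.
  (* Taking [m = n] in [mono] shows that the error term is nonnegative. *)
  exists K => _ [n _ <-]; rewrite /b lerBlDr (le_trans (mono n n (leqnn n))) //.
  by rewrite lerD2r.
have c_cvg : (fun n => c / n.+1%:R) @ \oo --> (0 : R).
  by rewrite -[X in _ --> X](mulr0 c); apply: cvgMr; exact: cvg_harmonic.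
suff /cvgP : b @ \oo --> sup (range b).
  move=> cb; have -> : a = b + (fun n => c / n.+1%:R).
    by apply/funext => n; rewrite /b /= fctE subrK.
  by apply: is_cvgD => //; apply: cvgP c_cvg.
apply/cvgrPdist_le => e e0.
have e20 : 0 < e / 2 by lra.
have [_ [n0 _ <-] hn0] := sup_adherent e20 ub.
have /cvgrPdist_le /(_ _ e20) := c_cvg.
move=> near_c; near=> m.
have b_le : b m <= sup (range b) by apply: ub_le_sup; [exact: ub.2|exists m].
rewrite ger0_norm ?subr_ge0 //.
have n0m : (n0 <= m)%N by near: m; exact: nbhs_infty_ge.
have := mono _ _ n0m; move: hn0; rewrite [b n0]/b [b m]/b.
have : `|0 - c / m.+1%:R| <= e / 2 by near: m.
rewrite sub0r normrN ler_norml => /andP[_].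
move: (sup _) (c / m.+1%:R) (c / n0.+1%:R).
by move=> s u v; lra.
Unshelve. all: by end_near.
Qed.

(** * From the rows of the matrix to the scalar recurrences *)

Section Coordinates.
Variable R : realType.
Implicit Types X Y : nat -> R.

(** Coordinates are functions on [nat], so that one vector, extended by zero, can be read in every
    size. *)
Definition cvec N X : 'cV[R]_N := \col_(i < N) X i.

Lemma cvecP N (x : 'cV[R]_N) :
  exists2 X, (forall i, (N <= i)%N -> X i = 0) & x = cvec N X.
Proof.
exists (fun i => oapp (fun j => x j 0) 0 (insub i)) => [i Ni|].
  by rewrite insubF // ltnNge Ni.
by apply/colP => i; rewrite mxE valK.
Qed.

Lemma sqr_norm2_cvec N X : norm2 (cvec N X) ^+ 2 = \sum_(i < N) X i ^+ 2.
Proof. by rewrite sqr_norm2; apply: eq_bigr => i _; rewrite mxE. Qed.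

Lemma norm2_cvec_widen N N' X : (N <= N')%N -> (forall i, (N <= i)%N -> X i = 0) ->
  norm2 (cvec N' X) = norm2 (cvec N X).
Proof.
move=> NN' X0; apply/eqP; rewrite -(@eqrXn2 _ 2) ?norm2_ge0 // !sqr_norm2_cvec.
rewrite -(subnKC NN') big_split_ord /= [X in _ + X]big1 ?addr0 // => i _.
by rewrite X0 ?expr0n // leq_addr.
Qed.

(** Pairs begin after [c = 5] columns, respectively after [c = 1] row. *)
Lemma sum_pairs (F : nat -> R) c N :
  \sum_(i < c + N.*2) F i
  = \sum_(i < c) F i + \sum_(r < N) (F (c + r.*2)%N + F (c + r.*2).+1).
Proof.
elim: N => [|N IH]; first by rewrite addn0 big_ord0 addr0.
by rewrite doubleS !addnS !big_ord_recr /= IH; ring.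
Qed.

(** The scalar in front of [Nblk R + Mblk R] in [Lblock R r k]. *)
Definition Lcoef r k : R :=
  (k.+1 == r)%:R * r%:R + ((k.+2 == r)%:R - (k == r)%:R) / 2.

(** [Nblk R + Mblk R] has [-1] in its top left corner and [1] elsewhere. *)
Lemma LblockE r k (a b : bool) :
  Lblock R r k (inord a) (inord b) = Lcoef r k * (-1) ^+ (~~ (a || b)).
Proof.
have i2 (c : bool) : (inord c : 'I_2) = if c then 1 else 0.
  by apply: val_inj; rewrite /= inordK; case: c.
rewrite /Lblock /Lcoef !i2 [k.+1 == r]eq_sym [k.+2 == r]eq_sym [k == r]eq_sym.
have [->|_] := eqVneq r k.
  rewrite (ltn_eqF (ltnSn k)) (ltn_eqF (leqnSn k.+1)).
  by case: a; case: b; rewrite !mxE /=; field.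
have [->|_] := eqVneq r k.+1.
  rewrite (ltn_eqF (ltnSn k.+1)).
  by case: a; case: b; rewrite !mxE /=; field.
have [->|_] := eqVneq r k.+2.
  by case: a; case: b; rewrite !mxE /=; field.
by rewrite mxE; case: a; case: b; rewrite /=; field.
Qed.

(* Component [a] of [Nblk + Mblk] applied to the coordinate pair r - 1. *)
Definition block_seq (a : bool) X r : R :=
  if r is k.+1 then (-1) ^+ (~~ a) * X (5 + k.*2)%N + X (5 + k.*2).+1 else 0.

(** Numbering the unknown of block column [k] by [k.+1] makes the diagonal coefficient the row
    number, and lets the zero value at [0] serve as boundary condition. *)
Lemma sum_Lcoef n r (H : nat -> R) : H 0%N = 0 ->
  (forall k, (n.+1 < k)%N -> H k = 0) -> (r < n.+3)%N ->
  \sum_(k < n.+1) Lcoef r k * H k.+1 = r%:R * H r + skew_part H r.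
Proof.
move=> H0 Hn rn; rewrite /Lcoef /skew_part.
have e1 : \sum_(k < n.+1) (k.+1 == r)%:R * H k.+1 = H r.
  case: r rn => [|r] rn; first by rewrite big1 ?H0 // => k _; rewrite mul0r.
  by rewrite (sum_delta (F := fun k => H k.+1)) // => nr; apply: Hn.
have e2 : \sum_(k < n.+1) (k.+2 == r)%:R * H k.+1 = H r.-1.
  case: r rn {e1} => [|[|r]] rn.
  - by rewrite big1 ?H0 // => k _; rewrite mul0r.
  - by rewrite big1 ?H0 // => k _; rewrite mul0r.
  by rewrite (sum_delta (F := fun k => H k.+1)) // => nr; apply: Hn.
have e3 : \sum_(k < n.+1) (val k == r)%:R * H k.+1 = H r.+1.
  by rewrite (sum_delta (F := fun k => H k.+1)) // => nr; apply: Hn.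
rewrite -e1 -e2 -e3 -sumrB mulr_sumr mulr_suml -big_split; apply: eq_bigr => k _.
by rewrite /=; ring.
Qed.

Lemma dim_cols n : (5 + (2 * n + 2) = 5 + n.+1.*2)%N. Proof. lia. Qed.
Lemma dim_rows n : (5 + (2 * n + 2) = 1 + n.+3.*2)%N. Proof. lia. Qed.

Lemma Lplus_row0 n X : \sum_(j < 5 + (2 * n + 2)) Lentry R n 0 j * X j = - X 0%N.
Proof.
rewrite dim_cols big_split_ord /= [X in _ + X]big1 => [|i _]; last by rewrite mul0r.
by rewrite !big_ord_recr big_ord0 /= !addnS /=; ring.
Qed.

(** [a = false] selects the V row of the block row, [a = true] the U row. Below the top row, the
    first column meets only the row of [U~_0], whence the source [a%:R * X 0%N]. *)
Lemma Lplus_row n (a : bool) r X : (r < n.+3)%N ->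
  (forall i, (5 + (2 * n + 2) <= i)%N -> X i = 0) ->
  \sum_(j < 5 + (2 * n + 2)) Lentry R n (1 + r.*2 + a) j * X j
  = rec_row n (X (1 + a)%N) (X (3 + a)%N) (a%:R * X 0%N) (block_seq a X) r.
Proof.
move=> rn X0; rewrite dim_cols (sum_pairs (fun j => Lentry R n _ j * X j)).
have step (k : 'I_n.+1) : Lentry R n (1 + r.*2 + a) (5 + k.*2) * X (5 + k.*2)%N
    + Lentry R n (1 + r.*2 + a) (5 + k.*2).+1 * X (5 + k.*2).+1
    = Lcoef r k * block_seq a X k.+1.
  rewrite /= !add0n; set q := k.*2.
  have -> : (r.*2 + a)./2 = r by rewrite addnC half_bit_double.
  have -> : q./2 = k by rewrite doubleK.
  have -> : uphalf q = k by rewrite uphalf_double.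
  have -> : odd (r.*2 + a) = a by rewrite oddD odd_double oddb.
  have -> : odd q = false by rewrite odd_double.
  by rewrite !LblockE orbF orbT; ring.
rewrite (eq_bigr _ (fun k _ => step k)).
rewrite sum_Lcoef // => [|k nk]; last first.
  by case: k nk => // k nk; rewrite /= !X0 ?mulr0 ?addr0 //; lia.
rewrite !big_ord_recr big_ord0 /= add0r.
rewrite /rec_row; congr (_ + _).
case: a {step}; rewrite /= ?addn0 ?addn1.
  rewrite (_ : (_ == 4)%N = (r == 1)%N); last by lia.
  rewrite (_ : ((1 + r.*2).+1 == 1)%N = false); last by lia.
  rewrite (_ : (_ == 2)%N = (r == 0)%N); last by lia.
  rewrite (_ : (_ == 2 * n + 5)%N = false); last by lia.
  rewrite (_ : (_ == 2 * n + 6)%N = (r == n.+2)%N); last by lia.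
  by case: (r == 1)%N; rewrite /=; ring.
rewrite (_ : (_ == 4)%N = false); last by lia.
rewrite (_ : (1 + _ == 1)%N = (r == 0)%N); last by lia.
rewrite (_ : (_ == 2)%N = false); last by lia.
rewrite (_ : (_ == 2 * n + 5)%N = (r == n.+2)%N); last by lia.
rewrite (_ : (_ == 2 * n + 6)%N = false); last by lia.
by rewrite /=; ring.
Qed.

End Coordinates.

(** * The preconditioned matrix: uniform bounds and convergence of its condition number *)

Section Preconditioned.
Variable R : realType.
Implicit Types X Y : nat -> R.

Definition Pentry (j : nat) : nat := if (j < 5)%N then 1%N else (j - 5)./2.+1.

Lemma PmxE n : Pmx R n = diag_mx (\row_j (Pentry j)%:R).
Proof.
apply/matrixP => i j; rewrite !mxE /Pentry.
case: (split_ordP i) => i' ->; rewrite !mxE;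
  case: (split_ordP j) => j' ->; rewrite !mxE.
- by rewrite eq_lshift.
- by rewrite (eq_lrshift i' j').
- by rewrite (eq_rlshift i' j').
- by rewrite eq_rshift /= addKn.
Qed.

Lemma Pmx_inv n :
  Pmx R n \in unitmx /\ invmx (Pmx R n) = diag_mx (\row_j (Pentry j)%:R^-1).
Proof.
have PV : Pmx R n *m diag_mx (\row_j (Pentry j)%:R^-1) = 1%:M.
  apply/matrixP => i j; rewrite PmxE mul_diag_mx !mxE mulrnAr divff //.
  by rewrite pnatr_eq0 /Pentry; case: ifP.
have [Pu _] := mulmx1_unit PV; split => //.
by rewrite -[RHS](mulKmx Pu) PV mulmx1.
Qed.

Lemma opnorm2_Pmx n : opnorm2 (Pmx R n) <= n.+1%:R.
Proof.
rewrite PmxE; apply: opnorm2_diag_le => // j; rewrite mxE normr_nat ler_nat.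
by have := ltn_ord j; rewrite /Pentry; case: ifP => //; lia.
Qed.

Lemma opnorm2_invmx_Pmx n : opnorm2 (invmx (Pmx R n)) <= 1.
Proof.
rewrite (Pmx_inv n).2; apply: opnorm2_diag_le => // j; rewrite mxE.
rewrite normfV normr_nat invf_le1 ?ler1n ?ltr0n /Pentry; by case: ifP.
Qed.

Definition LPmx n : 'M[R]_(5 + (2 * n + 2)) := Lplus R n *m invmx (Pmx R n).

Lemma LplusE n : Lplus R n = LPmx n *m Pmx R n.
Proof. by rewrite /LPmx mulmxKV ?(Pmx_inv n).1. Qed.

(* At r = 0 both the numerator and the junk value of the division are 0. *)
Definition precond_seq (a : bool) Y r : R := block_seq a Y r / r%:R.

Lemma precond_seq0 a Y : precond_seq a Y 0%N = 0.
Proof. by rewrite /precond_seq mul0r. Qed.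

Lemma precond_seq_eq0 n a Y : (forall i, (5 + (2 * n + 2) <= i)%N -> Y i = 0) ->
  forall r, (n.+1 < r)%N -> precond_seq a Y r = 0.
Proof.
move=> Y0 [//|r] nr; rewrite /precond_seq /= !Y0 ?mulr0 ?addr0 ?mul0r //; lia.
Qed.

Lemma sqr_norm2_LPmx n Y : (forall i, (5 + (2 * n + 2) <= i)%N -> Y i = 0) ->
  norm2 (LPmx n *m cvec _ Y) ^+ 2 = Y 0%N ^+ 2 +
    \sum_(a : bool) rec_sqnorm n (Y (1 + a)%N) (Y (3 + a)%N) (a%:R * Y 0%N)
                      (precond_seq a Y).
Proof.
move=> Y0; pose X i := Y i / (Pentry i)%:R.
have X0 i : (5 + (2 * n + 2) <= i)%N -> X i = 0.
  by move=> ni; rewrite /X Y0 ?mul0r.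
pose f i := \sum_(j < 5 + (2 * n + 2)) Lentry R n i j * X j.
have -> : LPmx n *m cvec _ Y = cvec _ f.
  rewrite /LPmx -mulmxA (Pmx_inv n).2; apply/colP => i; rewrite !mxE.
  apply: eq_bigr => j _; rewrite mul_diag_mx !mxE; congr (_ * _).
  by rewrite mulrC.
rewrite sqr_norm2_cvec dim_rows (sum_pairs (fun i => f i ^+ 2)).
rewrite big_ord1 /f Lplus_row0 sqrrN /X divr1 big_bool /= -big_split /=; congr (_ + _).
(* Both coordinates of a pair are divided by the same number, so preconditioning commutes with the
   action of [Nblk R + Mblk R]. *)
have hE (a : bool) : block_seq a X = precond_seq a Y.
  apply/funext => -[|r]; first by rewrite /precond_seq /= mul0r.
  rewrite /precond_seq /= /X /Pentry /= -!addnS !addKn doubleK uphalf_double.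
  by rewrite mulrDl mulrA.
apply: eq_bigr => r _.
have := @Lplus_row R n false r X (ltn_ord r) X0.
have := @Lplus_row R n true r X (ltn_ord r) X0.
rewrite [(1 + r.*2 + true)%N]addn1 [(1 + r.*2 + false)%N]addn0 => -> ->.
by rewrite !hE /X /= !divr1 addrC.
Qed.

(** [Nblk R + Mblk R] doubles the squared norm of each pair, hence the division by [2]; the end
    terms [r = 0] and [r = n.+2] are zero. *)
Lemma sqr_norm2_blocks n Y :
  (forall i, (5 + (2 * n + 2) <= i)%N -> Y i = 0) ->
  norm2 (cvec (5 + (2 * n + 2)) Y) ^+ 2 =
  \sum_(i < 5) Y i ^+ 2 +
  (\sum_(a : bool) weighted_sqnorm n (precond_seq a Y)) / 2.
Proof.
move=> Y0; rewrite sqr_norm2_cvec dim_cols (sum_pairs (fun i => Y i ^+ 2)); congr (_ + _).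
rewrite /weighted_sqnorm big_bool /= -big_split /= mulr_suml.
rewrite [RHS]big_ord_recr [X in _ = X + _]big_ord_recl /=.
rewrite (precond_seq_eq0 true Y0 (ltnSn n.+1)).
rewrite (precond_seq_eq0 false Y0 (ltnSn n.+1)) !mulr0 !mul0r expr0n addr0 mul0r addr0 add0r.
apply: eq_bigr => k _; rewrite /precond_seq ![(bump 0 k)%:R * _]mulrC !divfK ?pnatr_eq0 //.
by rewrite /= /bump /= add0n expr0 expr1; field.
Qed.

(** The factor [10] of [rec_sqnorm_le] against the halved weighted norms requires a squared constant
    of at least [20]. *)
Lemma norm2_LPmx_upper n (y : 'cV[R]_(5 + (2 * n + 2))) :
  norm2 (LPmx n *m y) <= 5 * norm2 y.
Proof.
have [Y Y0 ->] := cvecP y; apply: norm2_le => //.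
rewrite sqr_norm2_LPmx // sqr_norm2_blocks // !big_bool /=.
rewrite !big_ord_recr big_ord0 /= !addn1 !addn0.
have le (a : bool) := rec_sqnorm_le (Y (1 + a)%N) (Y (3 + a)%N) (a%:R * Y 0%N)
  (precond_seq0 a Y) (precond_seq_eq0 a Y0).
have := le false; have := le true; rewrite !addn1 !addn0 mul1r mul0r.
move: (sqr_ge0 (Y 0%N)) (sqr_ge0 (Y 1%N)) (sqr_ge0 (Y 2%N)).
move: (sqr_ge0 (Y 3%N)) (sqr_ge0 (Y 4%N)).
move: (weighted_sqnorm_ge0 n (precond_seq true Y)).
move: (weighted_sqnorm_ge0 n (precond_seq false Y)).
lra.
Qed.

(** The row of [U~_{-2}] supplies [Y 0%N ^+ 2], which absorbs the source term left over in
    [rec_sqnorm_ge]. *)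
Lemma norm2_LPmx_lower n (y : 'cV[R]_(5 + (2 * n + 2))) :
  norm2 y <= 5 * norm2 (LPmx n *m y).
Proof.
have [Y Y0 ->] := cvecP y; apply: norm2_le => //.
rewrite sqr_norm2_LPmx // sqr_norm2_blocks // !big_bool /=.
rewrite !big_ord_recr big_ord0 /= !addn1 !addn0.
have ge (a : bool) := rec_sqnorm_ge (Y (1 + a)%N) (Y (3 + a)%N) (a%:R * Y 0%N)
  (precond_seq0 a Y) (precond_seq_eq0 a Y0).
have := ge false; have := ge true; rewrite !addn1 !addn0 mul1r mul0r.
move: (sqr_ge0 (Y 0%N)).
move: (weighted_sqnorm_ge0 n (precond_seq true Y)).
move: (weighted_sqnorm_ge0 n (precond_seq false Y)).
have G0 (a : bool) := rec_sqnorm_ge0 n (Y (1 + a)%N) (Y (3 + a)%N) (a%:R * Y 0%N)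
  (precond_seq a Y).
have := G0 false; have := G0 true; rewrite !addn1 !addn0 mul1r mul0r.
lra.
Qed.

Lemma sqr_norm2_LPmx_widen n m Y : (n <= m)%N ->
  (forall i, (5 + (2 * n + 2) <= i)%N -> Y i = 0) ->
  `|norm2 (LPmx n *m cvec _ Y) ^+ 2 - norm2 (LPmx m *m cvec _ Y) ^+ 2|
  <= 2 / n.+1%:R * norm2 (cvec (5 + (2 * n + 2)) Y) ^+ 2.
Proof.
move=> nm Y0.
have Y0m i : (5 + (2 * m + 2) <= i)%N -> Y i = 0.
  by move=> mi; rewrite Y0 // (leq_trans _ mi) //; lia.
rewrite !sqr_norm2_LPmx // sqr_norm2_blocks // !big_bool /=.
rewrite !big_ord_recr big_ord0 /= !addn1 !addn0.
have dist (a : bool) := rec_sqnorm_widen_dist (Y (1 + a)%N) (Y (3 + a)%N) (a%:R * Y 0%N)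
  (precond_seq0 a Y) (precond_seq_eq0 a Y0) nm.
have := dist false; have := dist true; rewrite !addn1 !addn0 mul1r mul0r.
move: (weighted_sqnorm n (precond_seq true Y)).
move: (weighted_sqnorm n (precond_seq false Y)).
move: (rec_sqnorm m _ _ _ _) (rec_sqnorm m _ _ _ _).
move: (rec_sqnorm n _ _ _ _) (rec_sqnorm n _ _ _ _).
move=> f1 f0 g1 g0 w0 w1; rewrite !ler_norml => /andP[l1 u1] /andP[l0 u0].
(* The factor [2] makes up for the halved weighted norms. *)
have : (Y 4%N ^+ 2 + w1) / n.+1%:R + (Y 3%N ^+ 2 + w0) / n.+1%:R
    <= 2 / n.+1%:R * (0 + Y 0%N ^+ 2 + Y 1%N ^+ 2 + Y 2%N ^+ 2 + Y 3%N ^+ 2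
                      + Y 4%N ^+ 2 + (w1 + w0) / 2).
  rewrite -mulrDl [2 / _]mulrC -mulrA [leLHS]mulrC ler_wpM2l ?invr_ge0 //.
  have := sqr_ge0 (Y 0%N); have := sqr_ge0 (Y 1%N); have := sqr_ge0 (Y 2%N).
  by have := sqr_ge0 (Y 3%N); have := sqr_ge0 (Y 4%N); lra.
by move: (_ / _) (_ / _) (_ / _ * _) l1 u1 l0 u0 => p q r *; apply/andP; split; lra.
Qed.

Lemma LPmx_unit n : LPmx n \in unitmx.
Proof. exact: unitmx_bounded_below (@norm2_LPmx_lower n). Qed.

Lemma opnorm2_LPmx n : opnorm2 (LPmx n) <= 5.
Proof. exact: opnorm2_le (@norm2_LPmx_upper n). Qed.

Lemma opnorm2_invmx_LPmx n : opnorm2 (invmx (LPmx n)) <= 5.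
Proof. exact: opnorm2_invmx_le (@norm2_LPmx_lower n). Qed.

Lemma sqr_opnorm2_LPmx_mono n m : (n <= m)%N ->
  opnorm2 (LPmx n) ^+ 2 <= opnorm2 (LPmx m) ^+ 2 + 2 / n.+1%:R.
Proof.
move=> nm; have c0 : 0 <= opnorm2 (LPmx m) ^+ 2 + 2 / n.+1%:R.
  by rewrite addr_ge0 ?sqr_ge0 // divr_ge0.
apply: le_sqrt_sqr => //; first exact: opnorm2_ge0.
apply: opnorm2_le => [|y]; first exact: sqrtr_ge0.
apply: norm2_le; rewrite ?sqrtr_ge0 // (sqr_sqrtr c0).
have [Y Y0 ->] := cvecP y.
have := sqr_norm2_LPmx_widen nm Y0; rewrite ler_norml => /andP[_].
rewrite lerBlDl => /le_trans; apply; rewrite [leRHS]mulrDl lerD2r.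
rewrite -(norm2_cvec_widen _ Y0 (N' := 5 + (2 * m + 2))); last by lia.
by rewrite -exprMn sqr_le_of_le ?norm2_ge0 ?norm2_mulmx_le.
Qed.

(** Bounding [y] through size [m] and then passing to size [n] leaves an error
    [b ^+ 2 * (2 / n.+1%:R)] times the squared norm of [y]. Both [b ^+ 2] and the return to the
    image of [y] in size [n] cost [5 ^+ 2]. *)
Lemma sqr_opnorm2_invmx_LPmx_mono n m : (n <= m)%N ->
  opnorm2 (invmx (LPmx n)) ^+ 2
  <= opnorm2 (invmx (LPmx m)) ^+ 2 + 5 ^+ 4 * (2 / n.+1%:R).
Proof.
move=> nm; set b := opnorm2 (invmx (LPmx m)).
have e0 : 0 <= 2 / n.+1%:R :> R by rewrite divr_ge0.
have c0 : 0 <= b ^+ 2 + 5 ^+ 4 * (2 / n.+1%:R).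
  by rewrite addr_ge0 ?sqr_ge0 // mulr_ge0 ?exprn_ge0.
apply: le_sqrt_sqr => //; first exact: opnorm2_ge0.
apply: opnorm2_invmx_le => [|y]; first exact: sqrtr_ge0.
apply: norm2_le; rewrite ?sqrtr_ge0 // (sqr_sqrtr c0).
have [Y Y0 ->] := cvecP y.
have := sqr_norm2_LPmx_widen nm Y0; rewrite ler_norml => /andP[lo _].
have := norm2_LPmx_lower (cvec (5 + (2 * n + 2)) Y).
move=> /(sqr_le_of_le (norm2_ge0 _)); rewrite exprMn => hi.
have inv_m := norm2_le_invmx (cvec _ Y) (LPmx_unit m).
have {inv_m} := sqr_le_of_le (norm2_ge0 _) inv_m.
rewrite (norm2_cvec_widen _ Y0) ?exprMn -/b; last by lia.
have b25 : b ^+ 2 <= 5 ^+ 2.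
  by rewrite sqr_le_of_le ?opnorm2_ge0 // opnorm2_invmx_LPmx.
move: lo hi b25 (sqr_ge0 b) e0 (sqr_ge0 (norm2 (cvec (5 + (2 * n + 2)) Y))).
move: (norm2 _ ^+ 2) (norm2 _ ^+ 2) (norm2 _ ^+ 2) (b ^+ 2) (2 / _).
move=> q p x B e lo x_le B_le B0 e0 x0 /le_trans; apply.
have q_le : q <= p + e * x by lra.
apply: le_trans (ler_wpM2l B0 q_le) _; rewrite mulrDr mulrDl lerD2l.
have -> : 5 ^+ 4 * e * p = 5 ^+ 2 * (e * (5 ^+ 2 * p)) by ring.
apply: ler_pM => //; last exact: ler_wpM2l.
exact: mulr_ge0.
Qed.

(** Each factor converges because its square does and the square root is continuous. *)
Lemma cond2_LPmx_cvg : cvgn (fun n => cond2 (LPmx n)).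
Proof.
have cvg_sq (a : nat -> R) c : (forall n, 0 <= a n <= 5) ->
    (forall n m, (n <= m)%N -> a n ^+ 2 <= a m ^+ 2 + c / n.+1%:R) -> cvgn a.
  move=> a5 mono.
  have cvg_sq : cvgn (fun n => a n ^+ 2).
    apply: (almost_nondecreasing_cvg (K := 5 ^+ 2)) mono => n.
    by have /andP[? ?] := a5 n; apply: sqr_le_of_le.
  have -> : a = fun n => Num.sqrt (a n ^+ 2).
    by apply/funext => n; have /andP[? _] := a5 n; rewrite sqrtr_sqr ger0_norm.
  by apply: cvgP; apply: continuous_cvg cvg_sq; exact: sqrt_continuous.
apply: is_cvgM.
  apply: (cvg_sq _ 2) => [n|n m nm]; first by rewrite opnorm2_ge0 opnorm2_LPmx.
  exact: sqr_opnorm2_LPmx_mono.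
apply: (cvg_sq _ (5 ^+ 4 * 2)) => [n|n m nm].
  by rewrite opnorm2_ge0 opnorm2_invmx_LPmx.
by rewrite -mulrA sqr_opnorm2_invmx_LPmx_mono.
Qed.

End Preconditioned.

(** * Linear growth without preconditioning, and the limit with it *)

Unset Implicit Arguments.

(** Invertibility is included because it gives [cond2] its meaning. Independence of [n] is expressed
    by a uniform bound [K] together with a positive limit [C]. *)
Theorem proposition5p1 (R : realType) :
  [/\ forall n : nat, Lplus R n \in unitmx,
      (fun n : nat => cond2 (Lplus R n)) =O_\oo (fun n : nat => n%:R : R)
    & exists C K : R,
        [/\ 0 < C,
            forall n : nat, cond2 (Lplus R n *m invmx (Pmx R n)) <= K
          & cond2 (Lplus R n *m invmx (Pmx R n)) @[n --> \oo] --> C]].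
Proof.
have Lu n : Lplus R n \in unitmx.
  by rewrite LplusE unitmx_mul LPmx_unit (Pmx_inv R n).1.
split=> //.
(* One [5] for each operator norm, and [2] from [n.+1 <= 2 * n], valid for positive [n]. *)
- apply/eqO_exP; exists (2 * 5 * 5) => //; near=> n.
  have n_gt0 : (0 < n)%N by near: n; exact: nbhs_infty_gt.
  rewrite normr_nat ger0_norm ?mulr_ge0 ?opnorm2_ge0 //.
  have le_L : opnorm2 (Lplus R n) <= 5 * n.+1%:R.
    rewrite LplusE (le_trans (opnorm2_mul_le _ _)) //.
    by rewrite ler_pM ?opnorm2_ge0 ?opnorm2_LPmx ?opnorm2_Pmx.
  have le_Linv : opnorm2 (invmx (Lplus R n)) <= 5.
    apply: opnorm2_invmx_le => // x; rewrite LplusE -mulmxA.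
    apply: le_trans (norm2_LPmx_lower (Pmx R n *m x)).
    apply: le_trans (norm2_le_invmx x (Pmx_inv R n).1) _.
    by rewrite ler_piMl ?norm2_ge0 ?opnorm2_invmx_Pmx.
  have : cond2 (Lplus R n) <= 5 * n.+1%:R * 5.
    by rewrite ler_pM ?opnorm2_ge0.
  have : n.+1%:R <= 2 * n%:R :> R by rewrite -natrM ler_nat; lia.
  lra.
exists (limn (fun n => cond2 (LPmx R n))), (5 * 5); split.
- apply: lt_le_trans ltr01 _; apply: limr_ge; first exact: cond2_LPmx_cvg.
  by apply: nearW => n; apply: cond2_ge1; apply: LPmx_unit.
- by move=> n; rewrite ler_pM ?opnorm2_ge0 ?opnorm2_LPmx ?opnorm2_invmx_LPmx.
exact: cond2_LPmx_cvg.
Unshelve. all: by end_near.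
Qed.
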